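(* As formal power series in $q$, coefficientwise, $$\sum_{n=1}^{\infty} \overline{p}_{\omega}(n)q^n \equiv -1 +\sum_{m,n=0}^{\infty} (-1)^{m+n} q^{2(m^2+n^2)} + q \sum_{m,n=0}^{\infty} q^{2m(m+1)+2n(n+1)} \pmod{4}.$$
   Context: An overpartition of $n$ is a partition of $n$ in which the first occurrence of each distinct part may be overlined. $\overline{p}_{\omega}(n)$ denotes the number of overpartitions of $n$ in which the smallest part is overlined and all odd parts are less than twice the smallest part; equivalently $\sum_{n\ge1}\overline{p}_{\omega}(n)q^n=\sum_{n\ge1}\frac{q^n(-q^{n+1};q)_n(-q^{2n+2};q^2)_{\infty}}{(1-q^n)(q^{n+1};q)_n(q^{2n+2};q^2)_{\infty}}$, where $(a;q)_n=\prod_{j=0}^{n-1}(1-aq^j)$, $(a;q)_\infty=\prod_{j\ge0}(1-aq^j)$. *)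

(* Defs.v *)
From mathcomp Require Import all_boot all_order all_algebra.
Set Implicit Arguments. Unset Strict Implicit. Unset Printing Implicit Defensive.
Import GRing.Theory Num.Theory.

(* An overpartition of n is encoded by its multiplicity/overline data:
   for each possible part size i in {0,...,n}, x i = (m_i, o_i) where
   m_i is the number of copies of part i and o_i says whether the first
   occurrence of part i is overlined. *)
Definition overpart_data (n : nat) := {ffun 'I_n.+1 -> 'I_n.+1 * bool}.

Definition is_overpartition (n : nat) (x : overpart_data n) : bool :=
  [&& nat_of_ord (x ord0).1 == 0%N,
      (\sum_(i < n.+1) i * (x i).1)%N == n
    & [forall i, (x i).2 ==> (0 < (x i).1)%N]].

Definition omega_cond (n : nat) (x : overpart_data n) : bool :=
  [exists s : 'I_n.+1,
    [&& (0 < (x s).1)%N,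
        [forall i : 'I_n.+1, (i < s)%N ==> (nat_of_ord (x i).1 == 0%N)],
        (x s).2
      & [forall i : 'I_n.+1, ((0 < (x i).1)%N && odd i) ==> (i < 2 * s)%N]]].

Definition pbar_omega (n : nat) : nat :=
  #|[pred x : overpart_data n | @is_overpartition n x && @omega_cond n x]|.

Definition lhs_coef (N : nat) : int := if N is 0 then 0 else (pbar_omega N)%:Z.

(* coefficient of q^N in
   -1 + sum_{m,n>=0} (-1)^(m+n) q^(2(m^2+n^2)) + q sum_{m,n>=0} q^(2m(m+1)+2n(n+1)).
   Only m,n <= N can contribute to the coefficient of q^N. *)
Definition rhs_coef (N : nat) : int :=
  (- ((N == 0%N)%:Z)
   + \sum_(m < N.+1) \sum_(k < N.+1)
        (if (2 * (m ^ 2 + k ^ 2))%N == N then (-1) ^+ (m + k) else 0)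
   + \sum_(m < N.+1) \sum_(k < N.+1)
        (if (1 + (2 * (m * m.+1) + 2 * (k * k.+1)))%N == N then 1 else 0))%R.

(* Main.v *)
Require Import Defs.
From mathcomp Require Import all_boot all_order all_algebra.
From mathcomp Require Import zify.
Set Implicit Arguments. Unset Strict Implicit. Unset Printing Implicit Defensive.

(* A partition with k distinct part sizes carries 2^(k-1) admissible overlinings, so
   modulo 4 the count is d(N) + 2 C, where C counts the solutions of as + bt = N with
   s < t and t even or t < 2s. The parity of C comes from involutions. The solutions
   with t < 2s reduce to r, the number of representations N = c^2 + a^2 with c > a > 0.
   Those with t even, t >= 2s reduce first to solutions of cv + au = N with c > a, and
   then, comparing v with u, to r plus divisor sums. Zagier's involution (after removing
   the powers of 2 from N) evaluates r by divisor sums too, and these solutions turn out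
   to have the parity of #{xy = N, x < y} + [N is twice a square]. Altogether the count
   is [N is a square] + 2 r + 2 [N is twice a square] modulo 4, which is also what
   grouping (m, n) with (n, m) gives for the right-hand side. *)

(** * Counting in lists by bijections and involutions *)

Lemma count_le_inj (T1 T2 : eqType) (s1 : seq T1) (s2 : seq T2) (P : pred T1)
    (Q : pred T2) (f : T1 -> T2) :
  uniq s1 -> {in [seq x <- s1 | P x] &, injective f} ->
  (forall x, x \in s1 -> P x -> (f x \in s2) && Q (f x)) ->
  count P s1 <= count Q s2.
Proof.
move=> u1 injf fP; rewrite -!size_filter -(size_map f).
apply: uniq_leq_size; first by rewrite map_inj_in_uniq ?filter_uniq.
by move=> _ /mapP [x + ->]; rewrite !mem_filter andbC => /andP [xs Px]; rewrite andbC fP.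
Qed.

Lemma count_bij (T1 T2 : eqType) (s1 : seq T1) (s2 : seq T2) (P : pred T1) (Q : pred T2)
    (f : T1 -> T2) (g : T2 -> T1) :
  uniq s1 -> uniq s2 ->
  (forall x, x \in s1 -> P x -> [/\ f x \in s2, Q (f x) & g (f x) = x]) ->
  (forall y, y \in s2 -> Q y -> [/\ g y \in s1, P (g y) & f (g y) = y]) ->
  count P s1 = count Q s2.
Proof.
move=> u1 u2 fP gQ; apply/eqP; rewrite eqn_leq; apply/andP; split.
  apply: (count_le_inj (f := f)) => // [x y|x xs Px]; last by case: (fP x xs Px) => -> ->.
  rewrite !mem_filter => /andP [Px xs] /andP [Py ys] e.
  by have [_ _ <-] := fP x xs Px; rewrite e; have [_ _ ->] := fP y ys Py.
apply: (count_le_inj (f := g)) => // [x y|x xs Px]; last by case: (gQ x xs Px) => -> ->.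
rewrite !mem_filter => /andP [Px xs] /andP [Py ys] e.
by have [_ _ <-] := gQ x xs Px; rewrite e; have [_ _ ->] := gQ y ys Py.
Qed.

Lemma count_split (T : eqType) (s : seq T) (P Q1 Q2 : pred T) :
  {in s, forall x, P x = (Q1 x || Q2 x) /\ ~~ (Q1 x && Q2 x)} ->
  count P s = count Q1 s + count Q2 s.
Proof.
move=> h; rewrite -count_predUI -[LHS]addn0; congr (_ + _).
  by apply: eq_in_count => x /h [->].
by apply/esym/eqP; rewrite -leqn0 leqNgt -has_count; apply/hasPn => x /h [].
Qed.

(** The points moved by [f] pair off as [x] and [f x], so only the fixed points affect the
    parity. *)
Lemma odd_count_involution (T : eqType) (s : seq T) (P : pred T) (f : T -> T) :
  uniq s ->
  (forall x, x \in s -> P x -> [/\ f x \in s, P (f x) & f (f x) = x]) ->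
  odd (count P s) = odd (count (fun x => P x && (f x == x)) s).
Proof.
move=> us fP.
(* As [T] carries no order, positions in [s] decide which element of a pair comes first; [f]
   exchanges [L] and [G]. *)
pose L := fun x => P x && (index x s < index (f x) s).
pose G := fun x => P x && (index (f x) s < index x s).
have LG : count L s = count G s.
  apply: (count_bij (f := f) (g := f)) => // x xs /andP [Px h];
    by have [fs Pf ff] := fP x xs Px; split=> //; rewrite /G /L Pf ff.
rewrite (@count_split _ s P (fun x => P x && (f x == x)) (fun x => L x || G x)).
  rewrite (@count_split _ s (fun x => L x || G x) L G) ?LG ?addnn ?oddD ?odd_double ?addbF //.
  by move=> x xs; split=> //; rewrite /L /G; case: ltngtP; rewrite ?andbF.
move=> x xs; rewrite /L /G; case Px: (P x) => //=.
have [fs _ _] := fP x xs Px.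
have -> : (f x == x) = (index (f x) s == index x s).
  by apply/eqP/eqP => [->//|/(congr1 (nth x s))]; rewrite !nth_index.
by case: ltngtP.
Qed.

(** * Solutions of xy = N and of as + bt = N *)

Definition pairs (N : nat) : seq (nat * nat) :=
  [seq p <- allpairs pair (iota 1 N) (iota 1 N) | p.1 * p.2 == N].
(* [((a, s), (b, t)) \in quads N] encodes [a] parts of size [s] and [b] parts of size [t]
   with total [N]. *)
Definition quads (N : nat) : seq ((nat * nat) * (nat * nat)) :=
  [seq p <- allpairs pair (allpairs pair (iota 1 N) (iota 1 N)) (allpairs pair (iota 1 N) (iota 1
    N))
  | p.1.1 * p.1.2 + p.2.1 * p.2.2 == N].

Lemma mem_allpairs_pair (T1 T2 : eqType) (s1 : seq T1) (s2 : seq T2) x y :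
  ((x, y) \in allpairs pair s1 s2) = (x \in s1) && (y \in s2).
Proof.
apply/allpairsP/andP => [[[u v] /= [us vt [-> ->]]] //|[xs yt]].
by exists (x, y).
Qed.

Lemma mem_pairs N x y : ((x, y) \in pairs N) = [&& 0 < x, 0 < y & x * y == N].
Proof.
rewrite mem_filter mem_allpairs_pair !mem_iota /=.
apply/idP/idP; nia.
Qed.

Lemma mem_quads N a s b t :
  (((a, s), (b, t)) \in quads N) = [&& 0 < a, 0 < s, 0 < b, 0 < t & a * s + b * t == N].
Proof.
rewrite mem_filter !mem_allpairs_pair !mem_iota /=.
apply/idP/idP; nia.
Qed.

Lemma uniq_allpairs_pair (T1 T2 : eqType) (s1 : seq T1) (s2 : seq T2) :
  uniq s1 -> uniq s2 -> uniq (allpairs pair s1 s2).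
Proof.
by move=> u1 u2; apply: allpairs_uniq => // -[x y] [x' y'] _ _.
Qed.

Lemma pairs_uniq N : uniq (pairs N).
Proof. by rewrite filter_uniq // uniq_allpairs_pair ?iota_uniq. Qed.

Lemma quads_uniq N : uniq (quads N).
Proof. by rewrite filter_uniq // !uniq_allpairs_pair ?iota_uniq. Qed.

Local Notation square N := [exists x : 'I_N.+1, (0 < x) && (x * x == N)].
Local Notation twice_square N := [exists x : 'I_N.+1, (0 < x) && (x * x.*2 == N)].
Local Notation sum_of_squares N :=
  (count (fun '((c, s), (a, u)) => [&& c == s, a == u & a < c]) (quads N)).

(** * Bijections and involutions on the solutions of as + bt = N *)

Ltac quad :=
  lazymatch goal with
  | |- [/\ _, _ & _] => split; [rewrite mem_quads | | congr (_, _, (_, _))]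
  end.
Ltac intro_quad := case=> [[a s] [b t]]; rewrite mem_quads => /and5P [a0 s0 b0 t0 /eqP E].

(** With c = a + b and u = t - s one has N = cs + bu, where b < c and 0 < u < s. In these
    coordinates [f] exchanges c with s and b with u, which is conjugation of the partition. A fixed
    point has c = s and b = u, so N = c^2 + b^2. *)
Lemma count_quads_lt_double N :
  odd (count (fun '((a, s), (b, t)) => s < t < s.*2) (quads N)) =
  odd (sum_of_squares N).
Proof.
pose f (x : nat * nat * (nat * nat)) := let '((a, s), (b, t)) := x in
  ((s.*2 - t, a + b), (t - s, a + b.*2)).
rewrite (odd_count_involution (f := f)) ?quads_uniq //.
  congr (odd _).
  apply: (count_bij (f := fun '((a, s), (b, t)) => ((a + b, s), (b, t - s)))
                    (g := fun '((a, s), (b, t)) => ((a - b, s), (b, s + t))));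
                      rewrite ?quads_uniq //.
  - intro_quad.
    rewrite /f !xpair_eqE -!andbA => H.
    quad; nia.
  - intro_quad.
    rewrite /f !xpair_eqE -?andbA => H.
    quad; nia.
- intro_quad => H.
  rewrite /f; quad; nia.
Qed.

(** With t = 2v one has as + bt = (a + 2b) v + a (s - v), where s - v > 0; the new coefficient a +
    2b exceeds a and has the same parity. *)
Lemma count_quads_even_lt_double N :
  count (fun '((a, s), (b, t)) => ~~ odd t && (t < s.*2)) (quads N) =
  count (fun '((c, s), (a, u)) => (a < c) && (odd a == odd c)) (quads N).
Proof.
apply: (count_bij (f := fun '((a, s), (b, t)) => ((a + b.*2, t./2), (a, s - t./2)))
                    (g := fun '((a, s), (b, t)) => ((b, s + t), ((a - b)./2, s.*2))));
                      rewrite ?quads_uniq //.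
  - intro_quad => /andP [H1 H2].
    have {H1} ? : t = (t./2).*2 by lia.
    have [u ?] : exists u, s = t./2 + u by exists (s - t./2); lia.
    by quad; nia.
  - intro_quad => /andP [H1 H2].
    have [k ?] : exists k, a = b + k.*2 by exists ((a - b)./2); lia.
    by subst a; quad; nia.
Qed.

(** Exactly one of the two coefficients is even: the terms are reordered from larger coefficient
    first to even coefficient first. *)
Lemma count_quads_mixed N :
  count (fun '((c, s), (a, u)) => (a < c) && (odd a != odd c)) (quads N) =
  count (fun '((c, s), (a, u)) => ~~ odd c && odd a) (quads N).
Proof.
apply: (count_bij (f := fun '((a, s), (b, t)) =>
  if odd a then ((b, t), (a, s)) else ((a, s), (b, t)))
                    (g := fun '((a, s), (b, t)) =>
                      if a < b then ((b, t), (a, s)) else ((a, s), (b, t))));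
                      rewrite ?quads_uniq //.
  - intro_quad => H.
    case: ifP => H2; [have -> : b < a = true by lia|have -> : a < b = false by lia]; quad; lia.
  - intro_quad => H.
    case: ifP => H2; [have -> : odd b = true by lia|have -> : odd a = false by lia]; quad; lia.
Qed.

(** Together the two counts cover the solutions whose coefficients are not both odd, a set stable
    under exchanging the two terms. *)
Lemma count_quads_not_both_odd N :
  odd (count (fun '((c, s), (a, u)) => ~~ odd a) (quads N)
       + count (fun '((c, s), (a, u)) => ~~ odd c && odd a) (quads N)) =
  odd (count (fun '((c, s), (a, u)) => [&& c == a, s == u & ~~ odd c]) (quads N)).
Proof.
rewrite -(@count_split _ _ (fun '((c, s), (a, u)) => ~~ (odd c && odd a))); last first.
  by case=> [[c s] [a u]] _; case: (odd a); case: (odd c).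
rewrite (odd_count_involution (f := fun x => (x.2, x.1))) ?quads_uniq //.
  congr (odd _); apply: eq_count => -[[c s] [a u]] /=.
  rewrite !xpair_eqE; lia.
intro_quad => /= H; quad; lia.
Qed.

Lemma count_quads_even_weight N :
  count (fun '((a, s), (b, t)) => ~~ odd t) (quads N) =
  count (fun '((a, s), (b, t)) => ~~ odd b) (quads N).
Proof.
apply: (count_bij (f := fun '((a, s), (b, t)) => ((a, s), (t, b)))
                  (g := fun '((a, s), (b, t)) => ((a, s), (t, b)))); rewrite ?quads_uniq //;
  intro_quad => H; quad; lia.
Qed.

(** As many solutions have t even as b even. Those with t even and t < 2s match the solutions with a
    < c of equal parity. Modulo 2 this leaves all solutions with a < c, those with a even, and the
    mixed ones; exchanging terms reduces the last two kinds to the diagonal. *)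
Lemma count_quads_even_ge_double N :
  odd (count (fun '((a, s), (b, t)) => ~~ odd t && (s.*2 <= t)) (quads N)) =
  odd (count (fun '((c, s), (a, u)) => a < c) (quads N)
       + count (fun '((c, s), (a, u)) => [&& c == a, s == u & ~~ odd c]) (quads N)).
Proof.
have := count_quads_even_weight N.
rewrite (@count_split _ _ (fun '((a, s), (b, t)) => ~~ odd t)
  (fun '((a, s), (b, t)) => ~~ odd t && (t < s.*2))
  (fun '((a, s), (b, t)) => ~~ odd t && (s.*2 <= t))); last first.
  by case=> [[a s] [b t]] _; lia.
rewrite (@count_split _ (quads N) (fun '((c, s), (a, u)) => a < c)
  (fun '((c, s), (a, u)) => (a < c) && (odd a == odd c))
  (fun '((c, s), (a, u)) => (a < c) && (odd a != odd c))); last first.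
  by case=> [[a s] [b t]] _; lia.
have := count_quads_not_both_odd N.
rewrite count_quads_even_lt_double count_quads_mixed.
rewrite !oddD => h /(congr1 odd); move: h; rewrite !oddD.
by do !case: (odd (count _ _)).
Qed.

(** For u < s, exchange c with s and a with u; for s < u, exchange c with u and a with s. The fixed
    points give the first two counts, and the case s = u is kept as it is. *)
Lemma count_quads_lt N :
  odd (count (fun '((c, s), (a, u)) => a < c) (quads N)) =
  odd (sum_of_squares N
     + count (fun '((c, s), (a, u)) => [&& c == u, s == a & a < c]) (quads N)
     + count (fun '((c, s), (a, u)) => (s == u) && (a < c)) (quads N)).
Proof.
rewrite (@count_split _ (quads N) (fun '((c, s), (a, u)) => a < c)
  (fun '((c, s), (a, u)) => (s != u) && (a < c))
  (fun '((c, s), (a, u)) => (s == u) && (a < c))); last first.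
  by case=> [[a s] [b t]] _; lia.
rewrite (@count_split _ (quads N) (fun '((c, s), (a, u)) => (s != u) && (a < c))
  (fun '((c, s), (a, u)) => (u < s) && (a < c))
  (fun '((c, s), (a, u)) => (s < u) && (a < c))); last first.
  by case=> [[a s] [b t]] _; lia.
have e1 : odd (count (fun '((c, s), (a, u)) => (u < s) && (a < c)) (quads N)) =
   odd (sum_of_squares N).
  rewrite (odd_count_involution (f := fun '((c, s), (a, u)) => ((s, c), (u, a)))) ?quads_uniq //.
    congr (odd _); apply: eq_count => -[[c s] [a u]] /=.
    rewrite !xpair_eqE; lia.
  intro_quad => /= H; quad; lia.
have e2 : odd (count (fun '((c, s), (a, u)) => (s < u) && (a < c)) (quads N)) =
   odd (count (fun '((c, s), (a, u)) => [&& c == u, s == a & a < c]) (quads N)).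
  rewrite (odd_count_involution (f := fun '((c, s), (a, u)) => ((u, a), (s, c)))) ?quads_uniq //.
    congr (odd _); apply: eq_count => -[[c s] [a u]] /=.
    rewrite !xpair_eqE; lia.
  intro_quad => /= H; quad; lia.
by rewrite !oddD e1 e2 addbC addbA addbC addbA.
Qed.

(** With c + a = 2m, the involution keeps m and s and reflects a to m - a. A fixed point has m = 2a
    and c = 3a, so both coefficients can be replaced by 2a. *)
Lemma count_quads_same_size_even N :
  odd (count (fun '((c, s), (a, u)) => [&& s == u, a < c & ~~ odd (a + c)]) (quads N)) =
  odd (count (fun '((c, s), (a, u)) => [&& c == a, s == u & ~~ odd c]) (quads N)).
Proof.
rewrite (odd_count_involution
  (f := fun '((c, s), (a, u)) => (((c + a)./2 + a, s), ((c + a)./2 - a, u)))) ?quads_uniq //.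
  congr (odd _).
  apply: (count_bij (f := fun '((c, s), (a, u)) => ((a.*2, s), (a.*2, u)))
                    (g := fun '((c, s), (a, u)) => ((c + c./2, s), (c./2, u))));
                      rewrite ?quads_uniq //.
  - intro_quad.
    rewrite !xpair_eqE -!andbA => H.
    have ? : s = t by lia.
    have ? : a = b * 3 by lia.
    subst.
    quad; nia.
  - intro_quad.
    rewrite !xpair_eqE -?andbA => H.
    have ? : s = t by lia.
    have [k ?] : exists k, a = k.*2 by exists a./2; lia.
    have ? : b = k.*2 by lia.
    subst.
    rewrite !doubleK.
    quad; nia.
- intro_quad => H.
  have ? : s = t by lia.
  have [k ?] : exists k, a = b + k.*2 by exists ((a - b)./2); lia.
  subst.
  have -> : (b + k.*2 + b)./2 = b + k by lia.
  quad; nia.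
Qed.

Lemma count_quads_same_size N :
  odd (count (fun '((c, s), (a, u)) => (s == u) && (a < c)) (quads N)) =
  odd (count (fun '((c, s), (a, u)) => [&& c == a, s == u & ~~ odd c]) (quads N)
     + count (fun '((c, s), (a, u)) => [&& s == u, a < c & odd (a + c)]) (quads N)).
Proof.
rewrite oddD -count_quads_same_size_even -oddD; congr (odd _).
by apply: count_split => -[[c s] [a u]] _; lia.
Qed.

(** * Zagier's involution for odd N *)

(** Exchanging b and t leaves N = x^2 + b^2 with b even, hence x odd. The bijection then passes from
    the odd root first to the larger root first. *)
Lemma count_quads_square_even_even N : odd N ->
  odd (count (fun '((x, y), (b, t)) => [&& x == y, ~~ odd b & ~~ odd t]) (quads N)) =
  odd (sum_of_squares N).
Proof.
move=> oN.
rewrite (odd_count_involution (f := fun '((x, y), (b, t)) => ((x, y), (t, b)))) ?quads_uniq //.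
  congr (odd _).
  apply: (count_bij (f := fun '((x, y), (b, t)) =>
    if b < x then ((x, y), (b, t)) else ((b, t), (x, y)))
                    (g := fun '((x, y), (b, t)) =>
                      if odd x then ((x, y), (b, t)) else ((b, t), (x, y))));
   rewrite ?quads_uniq //.
  - intro_quad.
    rewrite !xpair_eqE -!andbA => H.
    have ? : a = s by lia.
    have ? : b = t by lia.
    subst.
    have o : odd s by nia.
    have o2 : odd t = false by lia.
    case: ifP => H2; rewrite ?o ?o2; quad; lia.
  - intro_quad => H.
    have ? : a = s by lia.
    have ? : b = t by lia.
    subst.
    have o : odd t = ~~ odd s by nia.
    case: ifP => H2; rewrite ?xpair_eqE ?eqxx ?o ?H2;
      [have -> : t < s by lia|have -> : s < t = false by lia]; quad; lia.
- intro_quad => H; quad; lia.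
Qed.

(* Zagier's involution on [x^2 + 4yz = N], with [b = 2y] and [t = 2z]; the boundary
   [x = y - z], empty for prime [N], is fixed pointwise here. *)
Definition zagier (p : (nat * nat) * (nat * nat)) : (nat * nat) * (nat * nat) :=
  let: ((x, y), (b, t)) := p in
  if x.*2 + t < b then ((x + t, x + t), (t, b - x.*2 - t))
  else if b == x.*2 + t then p
  else if x < b then ((b - x, b - x), (b, x.*2 + t - b))
  else ((x - b, x - b), (x.*2 + t - b, b)).

(** Since x is odd and b even, x = b never occurs. The two outer branches change x; the middle
    branch fixes exactly the solutions with b = 2x, and the boundary b = 2x + t is fixed by
    definition. *)
Lemma count_quads_zagier N : odd N ->
  odd (count (fun '((x, y), (b, t)) => [&& x == y, ~~ odd b & ~~ odd t]) (quads N)) =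
  odd (count (fun '((x, y), (b, t)) => [&& x == y, b == x.*2 & ~~ odd t]) (quads N)
     + count (fun '((x, y), (b, t)) => [&& x == y, b == x.*2 + t & ~~ odd t]) (quads N)).
Proof.
move=> oN; rewrite (odd_count_involution (f := zagier)) ?quads_uniq //.
  congr (odd _); apply: count_split => -[[a s] [b t]];
    rewrite mem_quads => /and5P [a0 s0 b0 t0 /eqP E].
  rewrite /zagier.
  case: ifP => H1; [|case: ifP => H2; [|case: ifP => H3]]; rewrite ?xpair_eqE -?andbA; lia.
intro_quad => H.
have ? : a = s by lia.
subst.
have o : odd s by nia.
rewrite /zagier; case: (ltnP (s.*2 + t) b) => [lt1 | le1].
  have [k ?] : exists k, b = s.*2 + t + k by exists (b - (s.*2 + t)); lia.
  subst; rewrite ifF; last by lia.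
  rewrite ifF; last by lia.
  rewrite ifF; last by lia.
  by quad; lia.
case: (b =P s.*2 + t) => [e|ne].
  by subst; rewrite /= ltnn !eqxx; quad; lia.
case: (ltnP s b) => [lt2 | le2].
  have [m ?] : exists m, b = s + m by exists (b - s); lia.
  have [l el] : exists l, s + t = m + l by exists (s + t - m); lia.
  (* Cancelling sm gives s^2 + (s + m) t = m^2 + (s + m) l, the invariance of N in the middle
     branch. *)
  have Em : (s + m) * (s + t) = (s + m) * (m + l) by rewrite el.
  have -> : s.*2 + t - b = l by lia.
  subst; rewrite addKn ifF; last by lia.
  rewrite ifF; last by lia.
  rewrite ifT; last by lia.
  by quad; lia.
have [k ?] : exists k, s = b + k by exists (s - b); lia.
subst; rewrite addKn.
have -> : (b + k).*2 + t - b = b + k.*2 + t by lia.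
rewrite ifT; last by lia.
by quad; lia.
Qed.

(** Here N = x^2 + 2xt = x (x + 2t) with t even, so the factors agree modulo 4. *)
Lemma count_quads_zagier_fixed N : odd N ->
  count (fun '((x, y), (b, t)) => [&& x == y, b == x.*2 & ~~ odd t]) (quads N) =
  count (fun '(x, y) => (x < y) && (x %% 4 == y %% 4)) (pairs N).
Proof.
move=> oN.
apply: (count_bij (f := fun '((x, y), (b, t)) => (x, x + t.*2))
                  (g := fun '(x, y) => ((x, x), (x.*2, (y - x)./2))));
                    rewrite ?quads_uniq ?pairs_uniq //.
- intro_quad => H.
  have ? : a = s by lia.
  have ? : b = s.*2 by lia.
  subst.
  split; [rewrite mem_pairs; nia | lia | congr (_, _, (_, _)); lia].
- case=> [x y]; rewrite mem_pairs => /and3P [x0 y0 /eqP E] H.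
  have [k ?] : exists k, y = x + (k * 4) by exists ((y - x) %/ 4); lia.
  subst; have -> : (x + k * 4 - x)./2 = k.*2 by lia.
  split; [rewrite mem_quads; nia | lia | congr (_, _); lia].
Qed.

(** Here N = x^2 + (2x + t) t = (x + t)^2, and the root x + t is split as c + a with a = t/2. *)
Lemma count_quads_zagier_boundary N : odd N ->
  count (fun '((x, y), (b, t)) => [&& x == y, b == x.*2 + t & ~~ odd t]) (quads N) =
  count (fun '((c, s), (a, u)) => [&& s == u, a < c & c + a == s]) (quads N).
Proof.
move=> oN.
apply: (count_bij (f := fun '((x, y), (b, t)) => ((x + t./2, x + t), (t./2, x + t)))
                  (g := fun '((c, s), (a, u)) => ((c - a, c - a), (c.*2, a.*2))));
                    rewrite ?quads_uniq //.
- intro_quad => H.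
  have ? : a = s by lia.
  have ? : b = s.*2 + t by lia.
  have [k ?] : exists k, t = k.*2 by exists t./2; lia.
  subst.
  rewrite doubleK.
  quad; nia.
- intro_quad => H.
  have ? : t = a + b by lia.
  have ? : s = a + b by lia.
  have [k ?] : exists k, a = b + k by exists (a - b); lia.
  subst.
  rewrite addKn doubleK.
  quad; nia.
Qed.

(** Put y = c + a, so N = sy with odd factors and 2a < y. If 2a < s, then [f] exchanges s and y and
    keeps a, without fixed points because s and y differ. Otherwise s < 2a < y and [f] reflects a to
    (s + y)/2 - a. The fixed point a = (s + y)/4 exists when 4 divides s + y, which for odd factors
    means that they differ modulo 4. *)
Lemma count_quads_same_size_ne N : odd N ->
  odd (count (fun '((c, s), (a, u)) => [&& s == u, a < c & c + a != s]) (quads N)) =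
  odd (count (fun '(x, y) => (x < y) && (x %% 4 != y %% 4)) (pairs N)).
Proof.
move=> oN.
pose f (p : (nat * nat) * (nat * nat)) := let: ((c, s), (a, u)) := p in
  if a.*2 < s then ((s - a, c + a), (a, c + a))
  else ((c + a - ((c + a + s)./2 - a), s), ((c + a + s)./2 - a, u)).
rewrite (odd_count_involution (f := f)) ?quads_uniq //.
  congr (odd _).
  apply: (count_bij (f := fun '((c, s), (a, u)) => (s, c + a))
                    (g := fun '(x, y) => ((y - (x + y) %/ 4, x), ((x + y) %/ 4, x))));
    rewrite ?quads_uniq ?pairs_uniq //.
  - intro_quad.
    rewrite -!andbA => /and4P [/eqP ? H1 H2].
    subst t.
    have E2 : s * (a + b) = N by lia.
    have [o1 o2] : odd s /\ odd (a + b) by move: oN; rewrite -E2 oddM => /andP.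
    rewrite /f; case: ifP => H3; rewrite !xpair_eqE -?andbA => H; first by lia.
    split; [rewrite mem_pairs; lia | lia | congr (_, _, (_, _)); lia].
  - case=> [x y]; rewrite mem_pairs => /and3P [x0 y0 /eqP E] H.
    have /andP [o1 o2] : odd x && odd y by rewrite -oddM E.
    have [k ?] : exists k, y + x = k * 4 by exists ((y + x) %/ 4); lia.
    have -> : (x + y) %/ 4 = k by lia.
    have E2 : (y - k) * x + k * x = N by rewrite -mulnDl -E mulnC; congr (_ * _); lia.
    rewrite /f; case: ifP => H3; first by lia.
    rewrite mem_quads E2 !xpair_eqE.
    split; [lia | lia | congr (_, _); lia].
intro_quad => /and3P [/eqP ? H1 H2].
subst t.
have E2 : (a + b) * s = N by lia.
have [o1 o2] : odd (a + b) /\ odd s by move: oN; rewrite -E2 oddM => /andP.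
rewrite /f; case: ifP => H3.
  have -> : b.*2 < a + b by lia.
  rewrite mem_quads -mulnDl subnK; last by lia.
  split; [rewrite mulnC; lia | lia | congr (_, _, (_, _)); lia].
case: ifP => H4; first by lia.
rewrite mem_quads -mulnDl subnK; last by lia.
split; [lia | lia | congr (_, _, (_, _)); lia].
Qed.

Lemma count_pairs_swap N (P : rel nat) :
  count (fun '(x, y) => P x y) (pairs N) = count (fun '(x, y) => P y x) (pairs N).
Proof.
by apply: (count_bij (f := fun '(x, y) => (y, x)) (g := fun '(x, y) => (y, x)));
  rewrite ?pairs_uniq // => -[x y]; rewrite !mem_pairs => /and3P [-> -> /eqP <-] ->;
  rewrite mulnC eqxx.
Qed.

Lemma size_pairs N :
  size (pairs N) = (count (fun '(x, y) => x < y) (pairs N)).*2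
                   + count (fun '(x, y) => x == y) (pairs N).
Proof.
rewrite -addnn [X in _ + X + _](count_pairs_swap N (fun x y => x < y)) -count_predT.
rewrite (@count_split _ _ predT (fun '(x, y) => (x < y) || (y < x)) (fun '(x, y) => x == y)).
  by congr (_ + _); apply: count_split => -[x y] _; lia.
by case=> x y _; rewrite /=; lia.
Qed.

Lemma count_pairs_diag N :
  count (fun '(x, y) => x == y) (pairs N) = square N.
Proof.
case: existsP => [[x /andP [x0 /eqP e]]|h].
  rewrite (@eq_in_count _ _ (pred1 (x : nat, x : nat))); last first.
    case=> [a b]; rewrite mem_pairs => /and3P [_ _ /eqP e2]; rewrite /= xpair_eqE; nia.
  by rewrite count_uniq_mem ?pairs_uniq // mem_pairs x0 e eqxx.
apply/eqP; rewrite -leqn0 leqNgt -has_count; apply/hasPn => -[a b].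
rewrite mem_pairs => /and3P [a0 _ /eqP e]; apply/negP => /eqP ?; subst b.
have aN : a < N.+1 by nia.
by case: h; exists (Ordinal aN); rewrite /= a0 e eqxx.
Qed.

(** All divisors being odd, half their number (rounded down) counts xy = N with x < y. Zagier's
    involution accounts for x, y equal modulo 4, [count_quads_same_size_ne] for the others, and the
    boundary terms cancel. *)
Lemma count_quads_squares_odd N : odd N ->
  odd (sum_of_squares N) =
  odd ((count (fun '(x, y) => odd x) (pairs N))./2
       + count (fun '((c, s), (a, u)) => [&& s == u, a < c & odd (a + c)]) (quads N)).
Proof.
move=> oN.
have -> : count (fun '(x, y) => odd x) (pairs N) = size (pairs N).
  apply/eqP; rewrite -all_count; apply/allP => -[x y]; rewrite mem_pairs => /and3P [_ _ /eqP E].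
  by move: oN; rewrite -E oddM => /andP [].
rewrite size_pairs [_.*2 + _]addnC count_pairs_diag half_bit_double.
rewrite -(count_quads_square_even_even oN) (count_quads_zagier oN).
rewrite (count_quads_zagier_fixed oN) (count_quads_zagier_boundary oN).
rewrite (@count_split _ (pairs N) (fun '(x, y) => x < y)
  (fun '(x, y) => (x < y) && (x %% 4 == y %% 4))
  (fun '(x, y) => (x < y) && (x %% 4 != y %% 4))); last first.
  by case=> x y _; lia.
rewrite (@count_split _ (quads N) (fun '((c, s), (a, u)) => [&& s == u, a < c & odd (a + c)])
  (fun '((c, s), (a, u)) => [&& s == u, a < c & c + a == s])
  (fun '((c, s), (a, u)) => [&& s == u, a < c & c + a != s])); last first.
  intro_quad. case: (s =P t) => [?|] //=.
  subst t.
  (* The sum a + b divides the odd number N, so its parity condition is automatic. *)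
  have : odd ((a + b) * s) by rewrite mulnDl E.
  rewrite oddM; lia.
rewrite !oddD (count_quads_same_size_ne oN).
by do !case: (odd (count _ _)).
Qed.

(** * Removal of the powers of 2, and the count for t even, t >= 2s *)

(** (c + a)^2 + (c - a)^2 = 2 (c^2 + a^2): up to order this is multiplication by 1 + i in the
    Gaussian integers, and it is invertible because roots of an even sum have equal parity. *)
Lemma count_quads_squares_double N :
  sum_of_squares N.*2 =
  sum_of_squares N.
Proof.
apply: (count_bij (f := fun '((c, s), (a, u)) =>
  (((c + a)./2, (s + u)./2), ((c - a)./2, (s - u)./2)))
                  (g := fun '((c, s), (a, u)) => ((c + a, s + u), (c - a, s - u))));
                    rewrite ?quads_uniq //.
- intro_quad => H.
  have ? : a = s by lia.
  have ? : b = t by lia.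
  subst.
  have o : odd s = odd t by nia.
  have [k ?] : exists k, s = t + k.*2 by exists (s - t)./2; lia.
  subst.
  have -> : (t + k.*2 + t)./2 = t + k by lia.
  have -> : (t + k.*2 - t)./2 = k by lia.
  quad; nia.
- intro_quad => H.
  have ? : a = s by lia.
  have ? : b = t by lia.
  subst.
  have [k ?] : exists k, s = t + k by exists (s - t); lia.
  subst.
  rewrite addKn.
  quad; nia.
Qed.

(** The equation (a + c) s = 2N with a + c odd forces s to be even. *)
Lemma count_quads_same_size_odd_double N :
  count (fun '((c, s), (a, u)) => [&& s == u, a < c & odd (a + c)]) (quads N.*2) =
  count (fun '((c, s), (a, u)) => [&& s == u, a < c & odd (a + c)]) (quads N).
Proof.
apply: (count_bij (f := fun '((c, s), (a, u)) => ((c, s./2), (a, u./2)))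
                  (g := fun '((c, s), (a, u)) => ((c, s.*2), (a, u.*2)))); rewrite ?quads_uniq //.
- intro_quad => H.
  have ? : s = t by lia.
  subst.
  have : ~~ odd ((a + b) * t) by rewrite mulnDl E odd_double.
  rewrite oddM => o.
  have [k ?] : exists k, t = k.*2 by exists t./2; lia.
  subst.
  rewrite doubleK.
  quad; nia.
- intro_quad => H.
  have ? : s = t by lia.
  subst.
  rewrite !doubleK.
  quad; nia.
Qed.

Lemma count_pairs_odd_double N :
  count (fun '(x, y) => odd x) (pairs N.*2) = count (fun '(x, y) => odd x) (pairs N).
Proof.
apply: (count_bij (f := fun '(x, y) => (x, y./2)) (g := fun '(x, y) => (x, y.*2)));
  rewrite ?pairs_uniq // => -[x y]; rewrite mem_pairs => /and3P [x0 y0 /eqP E] o.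
  have [k ?] : exists k, y = k.*2 by exists y./2; nia.
  subst; rewrite doubleK mem_pairs; split=> //; nia.
by rewrite doubleK mem_pairs; split=> //; nia.
Qed.

(** None of the three counts changes when N is doubled, so induction descends to odd N. *)
Lemma count_quads_squares N :
  odd (sum_of_squares N) =
  odd ((count (fun '(x, y) => odd x) (pairs N))./2
       + count (fun '((c, s), (a, u)) => [&& s == u, a < c & odd (a + c)]) (quads N)).
Proof.
elim/ltn_ind: N => N IH; case oN: (odd N); first exact: count_quads_squares_odd.
have eN : N = N./2.*2 by lia.
have [->//|N0] := posnP N.
rewrite eN count_quads_squares_double count_quads_same_size_odd_double count_pairs_odd_double.
by apply: IH; lia.
Qed.

(** With c = u and s = a the equation reads N = 2ac. Halving the even factor turns the left side
    into the number of divisors of N/2, which pair off except when N/2 is a square. *)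
Lemma count_quads_swapped N :
  count (fun '(x, y) => ~~ odd x) (pairs N) =
  (count (fun '((c, s), (a, u)) => [&& c == u, s == a & a < c]) (quads N)).*2
  + twice_square N.
Proof.
case oN: (odd N).
  rewrite (@eq_in_count _ _ pred0) ?count_pred0; last first.
    by case=> x y; rewrite mem_pairs => /and3P [_ _ /eqP E]; move: oN;
      rewrite -E oddM => /andP [->].
  rewrite (@eq_in_count _ _ pred0 (quads N)) ?count_pred0; last first.
    intro_quad => /=. nia.
  case: existsP => // -[x /andP [_ /eqP]]; lia.
have eN : N = N./2.*2 by lia.
have -> : count (fun '(x, y) => ~~ odd x) (pairs N) = size (pairs N./2).
  rewrite -count_predT.
  apply: (count_bij (f := fun '(x, y) => (x./2, y)) (g := fun '(x, y) => (x.*2, y)));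
    rewrite ?pairs_uniq // => -[x y]; rewrite !mem_pairs => /and3P [x0 y0 /eqP E] o.
    have [k ?] : exists k, x = k.*2 by exists x./2; lia.
    subst; rewrite doubleK; split=> //; nia.
  by rewrite doubleK; split=> //; nia.
rewrite size_pairs count_pairs_diag; congr (_.*2 + nat_of_bool _).
  apply: (count_bij (f := fun '(x, y) => ((y, x), (x, y))) (g := fun '((c, s), (a, u)) =>
    (a, c)));
    rewrite ?quads_uniq ?pairs_uniq //.
    case=> x y; rewrite mem_pairs mem_quads => /and3P [x0 y0 /eqP E] o; split=> //; nia.
  by intro_quad => H; rewrite mem_pairs; split; [nia | lia | congr (_, _, (_, _)); lia].
apply/existsP/existsP => -[x /andP [x0 /eqP E]].
  have xN : x < N.+1 by nia.
  by exists (Ordinal xN); rewrite /= x0; nia.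
have xN : x < N./2.+1 by nia.
by exists (Ordinal xN); rewrite /= x0; nia.
Qed.

(** Infinite descent: x and then y must be even. *)
Lemma square_not_twice_square x y : 0 < x -> x * x <> (y * y).*2.
Proof.
elim/ltn_ind: x y => x IH y x0 E.
have [k kx] : exists k, x = k.*2 by exists x./2; nia.
have [l ly] : exists l, y = l.*2 by exists y./2; nia.
apply: (IH k _ l); nia.
Qed.

(** Chaining the reductions, the diagonal terms cancel modulo 2, and [count_quads_squares] leaves
    half the number of odd divisors plus the solutions of N = 2ac with a < c. Counting all divisors
    by parity turns this into the right side. *)
Lemma count_quads_even_ge_double_pairs N :
  odd (count (fun '((a, s), (b, t)) => ~~ odd t && (s.*2 <= t)) (quads N)) =
  odd (count (fun '(x, y) => x < y) (pairs N) + twice_square N).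
Proof.
have h1 := count_quads_even_ge_double N.
have h2 := count_quads_lt N.
have h3 := count_quads_same_size N.
have h4 := count_quads_squares N.
have h5 := count_quads_swapped N.
have h6 := size_pairs N.
have h7 : size (pairs N) = count (fun '(x, y) => odd x) (pairs N) + count (fun '(x, y) =>
  ~~ odd x) (pairs N).
  by rewrite -count_predT; apply: count_split => -[x y] _; case: (odd x).
(* The divisor identity is about to be halved; the rounding is correct only because N is not both a
   square and twice a square. *)
have h8 : ~~ (square N && twice_square N).
  apply/negP => /andP [/existsP [x /andP [x0 /eqP Ex]] /existsP [y /andP [y0 /eqP Ey]]].
  by apply: (@square_not_twice_square x y x0); rewrite doubleMr Ey.
rewrite count_pairs_diag in h6.
have -> : count (fun '(x, y) => x < y) (pairs N) = (count (fun '(x, y) => odd x) (pairs N))./2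
    + count (fun '((c, s), (a, u)) => [&& c == u, s == a & a < c]) (quads N)
    + twice_square N.
  clear -h5 h6 h7 h8; move: h5 h6 h7 h8.
  move: (count _ (quads N)) (size _) => ? ?.
  do !move: (count _ (pairs N)) => ?.
  by do 2 case: [exists _, _] => //=; lia.
rewrite -addnA addnn [in RHS]oddD odd_double addbF oddD.
rewrite h1 oddD h2 !oddD h3 oddD h4 oddD.
do !move: (odd (count _ (quads N))) => ?.
by move: (odd _./2) => ?; do !match goal with b : bool |- _ => case: b end.
Qed.

(** * From overpartitions to partitions with one or two part sizes *)

Section Multiplicities.
Variable n : nat.
Implicit Types (m : {ffun 'I_n.+1 -> 'I_n.+1}) (s t : 'I_n.+1).

Definition parts m : {set 'I_n.+1} := [set i | 0 < m i].

(* [s] is the smallest part of the partition with multiplicities [m]. *)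
Definition omega_partition m s : bool :=
  [&& m ord0 == 0 :> nat, (\sum_(i < n.+1) i * m i)%N == n, 0 < m s,
      [forall i : 'I_n.+1, (i < s) ==> (m i == 0 :> nat)]
    & [forall i : 'I_n.+1, ((0 < m i) && odd i) ==> (i < 2 * s)]].

Definition mults (x : overpart_data n) : {ffun 'I_n.+1 -> 'I_n.+1} := [ffun i => (x i).1].

Definition overlined_at (x : overpart_data n) s : bool :=
  [forall i, (x i).2 ==> (0 < (x i).1)] && (x s).2.

Lemma omega_partition_inj m s t : omega_partition m s -> omega_partition m t -> s = t.
Proof.
move=> /and5P [_ _ s0 /forallP hs _] /and5P [_ _ t0 /forallP ht _].
apply: val_inj => /=; move: (hs t) (ht s) => /implyP hs' /implyP ht'; lia.
Qed.

(** The smallest part is unique, so the existential becomes a sum with at most one term, ready to be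
    exchanged with the sum over multiplicities. *)
Lemma overpartition_omegaE (x : overpart_data n) :
  nat_of_bool (is_overpartition x && omega_cond x) =
  \sum_(s | omega_partition (mults x) s && overlined_at x s) 1.
Proof.
have E s : omega_partition (mults x) s && overlined_at x s =
  is_overpartition x && [&& (0 < (x s).1)%N,
        [forall i : 'I_n.+1, (i < s)%N ==> (nat_of_ord (x i).1 == 0%N)],
        (x s).2
      & [forall i : 'I_n.+1, ((0 < (x i).1)%N && odd i) ==> (i < 2 * s)%N]].
  have e i : mults x i = (x i).1 by rewrite ffunE.
  rewrite /omega_partition /overlined_at /is_overpartition !e.
  rewrite (eq_bigr (fun i : 'I_n.+1 => i * (x i).1)) => [|i _]; last by rewrite e.
  rewrite (@eq_forallb _ (fun i : 'I_n.+1 => (i < s) ==> (mults x i == 0 :> nat))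
    (fun i : 'I_n.+1 => (i < s) ==> ((x i).1 == 0 :> nat))) => [|i]; last by rewrite e.
  rewrite (@eq_forallb _ (fun i : 'I_n.+1 => ((0 < mults x i) && odd i) ==> (i < 2 * s))
    (fun i : 'I_n.+1 => ((0 < (x i).1) && odd i) ==> (i < 2 * s))) => [|i]; last by rewrite e.
  case: (_ == _); case: (_ == _); case: (0 < _); case: (x s).2; do 3 case: [forall _, _] => //.
case: (boolP (_ && _)) => [/andP [h1 /existsP [s hs]]|h].
  rewrite (big_pred1 s) // => t; rewrite inE; apply/idP/eqP => [/andP [ht _]|->];
    last by rewrite E h1 hs.
  by apply: omega_partition_inj ht _; have := E s; rewrite h1 hs => /andP [].
rewrite big_pred0 // => s; rewrite E; apply/negbTE; apply: contraNN h => /andP [-> hs] /=.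
by apply/existsP; exists s.
Qed.

(** The overline on s is forced, and any subset of the other part sizes may be overlined. *)
Lemma card_overlined m s : 0 < m s ->
  #|[pred x : overpart_data n | (mults x == m) && overlined_at x s]| = 2 ^ (#|parts m|.-1).
Proof.
move=> ms.
have -> : #|parts m|.-1 = #|parts m :\ s| by rewrite (cardsD1 s (parts m)) inE ms.
rewrite -card_powerset.
pose f (A : {set 'I_n.+1}) : overpart_data n := [ffun i => (m i, (i == s) || (i \in A))].
rewrite -(card_in_imset (f := f)); last first.
  move=> A B; rewrite !inE => /subsetP hA /subsetP hB /ffunP e; apply/setP => i.
  have /(congr1 snd) := e i; rewrite !ffunE /=; case: (i =P s) => [-> _|//].
  by apply/idP/idP => [/hA|/hB]; rewrite !inE eqxx.
apply: eq_card => x; rewrite !inE; apply/andP/imsetP => [[/eqP e /andP [/forallP h1 h2]]|[A]].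
  exists [set i | (i != s) && (x i).2].
    rewrite inE; apply/subsetP => i; rewrite !inE => /andP [-> xi] /=.
    by rewrite -e ffunE (implyP (h1 i)).
  apply/ffunP => i; rewrite !ffunE inE -e ffunE.
  by case: (i =P s) => [->|_] /=; [rewrite -h2|]; apply: surjective_pairing.
rewrite inE => /subsetP hA ->; split; first by apply/eqP/ffunP => i; rewrite !ffunE.
apply/andP; split; last by rewrite ffunE eqxx.
apply/forallP => i; rewrite !ffunE /=; apply/implyP => /orP [/eqP ->//|/hA].
by rewrite !inE => /andP [].
Qed.

Lemma pbar_omega_sum :
  pbar_omega n = \sum_(p : {ffun 'I_n.+1 -> 'I_n.+1} * 'I_n.+1 | omega_partition p.1 p.2) 2 ^
    (#|parts p.1|.-1).
Proof.
rewrite /pbar_omega -sum1_card big_mkcond /=.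
under eq_bigr => x _.
  have -> : (if x \in [pred x | is_overpartition x && omega_cond x] then 1 else 0) =
    nat_of_bool (is_overpartition x && omega_cond x).
    by rewrite inE; case: (_ && _).
  rewrite overpartition_omegaE. over.
rewrite (eq_bigr (fun p =>
  \sum_(x : overpart_data n | (mults x == p.1) && overlined_at x p.2) 1)); last first.
  by move=> [m s] /= /and5P [_ _ ms _ _]; rewrite -(card_overlined ms) sum1_card.
rewrite -(pair_big_dep xpredT (fun m s => omega_partition m s)
   (fun m s => \sum_(x : overpart_data n | (mults x == m) && overlined_at x s) 1)) /=.
rewrite (partition_big mults xpredT) //=; apply: eq_bigr => m _.
rewrite (exchange_big_dep (omega_partition m)) /=; last by move=> x s /eqP -> /andP [].
apply: eq_bigr => s ok; apply: eq_bigl => x.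
by case: eqP => //= ->; rewrite ok.
Qed.

Lemma expn2_pred_mod4 k : 0 < k ->
  2 ^ k.-1 = (k == 1) + 2 * (k == 2) + 4 * (if 2 < k then 2 ^ (k - 3) else 0).
Proof. by case: k => [|[|[|k]]] // _; rewrite /= -[k.+3]addn3 addnK !expnS mulnA. Qed.

(** The weight 2^(k-1) is divisible by 4 as soon as there are k >= 3 part sizes. *)
Lemma pbar_omega_mod4 :
  pbar_omega n =
  #|[pred p : {ffun 'I_n.+1 -> 'I_n.+1} * 'I_n.+1 | omega_partition p.1 p.2 && (#|parts p.1| ==
    1)]|
  + 2 * #|[pred p : {ffun 'I_n.+1 -> 'I_n.+1} * 'I_n.+1 | omega_partition p.1 p.2 && (#|parts
      p.1| == 2)]|
  %[mod 4].
Proof.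
rewrite pbar_omega_sum (eq_bigr (fun p : {ffun 'I_n.+1 -> 'I_n.+1} * 'I_n.+1 =>
  (#|parts p.1| == 1) + 2 * (#|parts p.1| == 2)
   + 4 * (if 2 < #|parts p.1| then 2 ^ (#|parts p.1| - 3) else 0))); last first.
  move=> [m s] /= /and5P [_ _ ms _ _]; apply: expn2_pred_mod4.
  by apply/card_gt0P; exists s; rewrite inE.
rewrite 2!big_split -!big_distrr /= addnC [4 * _]mulnC modnMDl.
by congr ((_ + 2 * _) %% 4); rewrite -sum1_card [LHS]big_mkcond [RHS]big_mkcond /=;
  apply: eq_bigr => p _; rewrite !inE; case: (omega_partition _ _) => //=; case: (_ == _).
Qed.

Definition mult1 s (a : 'I_n.+1) : {ffun 'I_n.+1 -> 'I_n.+1} :=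
  [ffun i => if i == s then a else ord0].
Definition mult2 s t (a b : 'I_n.+1) : {ffun 'I_n.+1 -> 'I_n.+1} :=
  [ffun i => if i == s then a else if i == t then b else ord0].

Lemma omega_partition_mult1 s (a : 'I_n.+1) :
  omega_partition (mult1 s a) s = [&& 0 < a, 0 < s & a * s == n].
Proof.
rewrite /omega_partition (bigD1 s) //= big1; last by move=> i /negPf ns; rewrite ffunE ns muln0.
rewrite addn0 !ffunE eqxx [s * a]mulnC.
have -> : [forall i : 'I_n.+1, (i < s) ==> (mult1 s a i == 0 :> nat)].
  by apply/forallP => i; rewrite ffunE; case: (i =P s) => [->|_]; rewrite ?ltnn ?implybT.
have -> : [forall i : 'I_n.+1, ((0 < mult1 s a i) && odd i) ==> (i < 2 * s)] =
  (0 < a) && odd s ==> (0 < s).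
  apply/forallP/idP => [/(_ s)|h i]; rewrite !ffunE ?eqxx /=; first by lia.
  by case: (i =P s) => [->|_] //=; lia.
by rewrite -val_eqE /=; case: ifP => es /=; case: (_ * _ == _); rewrite ?andbT ?andbF /=; lia.
Qed.

(** The bound on odd parts is automatic for s, so it constrains only t. *)
Lemma omega_partition_mult2 s t (a b : 'I_n.+1) : s < t -> 0 < b ->
  omega_partition (mult2 s t a b) s =
  [&& 0 < a, 0 < s, a * s + b * t == n & ~~ odd t || (t < 2 * s)].
Proof.
move=> st b0; have nts : t != s by rewrite -val_eqE /=; lia.
rewrite /omega_partition (bigD1 s) //= (bigD1 t) //= big1; last first.
  by move=> i /andP [/negPf ns /negPf nt]; rewrite ffunE ns nt muln0.
rewrite addn0 !ffunE !eqxx (negPf nts) [s * a]mulnC [t * b]mulnC.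
have -> : [forall i : 'I_n.+1, (i < s) ==> (mult2 s t a b i == 0 :> nat)].
  apply/forallP => i; rewrite ffunE; case: (i =P s) => [->|_]; rewrite ?ltnn //.
  by case: (i =P t) => [->|_]; rewrite ?implybT //; lia.
have -> : [forall i : 'I_n.+1, ((0 < mult2 s t a b i) && odd i) ==> (i < 2 * s)]
   = ((0 < a) && odd s ==> (0 < s)) && (odd t ==> (t < 2 * s)).
  apply/forallP/andP => [h|[h1 h2] i].
    by split; [have := h s | have := h t]; rewrite !ffunE ?eqxx ?(negPf nts) /=; lia.
  by rewrite ffunE; case: (i =P s) => [->|_]; [|case: (i =P t) => [->|_]] => //=; lia.
rewrite -!val_eqE /= ?[0 == t]ltn_eqF; last by lia.
by case: ifP => es /=; case: (_ + _ == _); rewrite ?andbT ?andbF /=; lia.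
Qed.

Lemma parts_mult1 s (a : 'I_n.+1) : 0 < a -> parts (mult1 s a) = [set s].
Proof.
by move=> a0; apply/setP => i; rewrite !inE ffunE; case: (i =P s).
Qed.

Lemma mult1E m s : 0 < m s -> #|parts m| == 1 -> m = mult1 s (m s).
Proof.
move=> ms /cards1P [t pt].
have st : s = t by apply/set1P; rewrite -pt inE.
apply/ffunP => i; rewrite ffunE; case: (i =P s) => [->//|/eqP ni].
apply: val_inj => /=; apply/eqP; rewrite -leqn0 leqNgt; apply: contraNN ni => mi.
by rewrite st -in_set1 -pt inE.
Qed.

Lemma parts_mult2 s t (a b : 'I_n.+1) : s != t -> 0 < a -> 0 < b ->
  parts (mult2 s t a b) = [set s; t].
Proof.
move=> st a0 b0; apply/setP => i; rewrite !inE ffunE.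
by case: (i =P s) => //=; case: (i =P t).
Qed.

Lemma mult2E m s : omega_partition m s -> #|parts m| == 2 ->
  exists2 t : 'I_n.+1, s < t /\ 0 < m t & m = mult2 s t (m s) (m t).
Proof.
move=> /and5P [_ _ ms /forallP hs _] c2.
have /cards1P [t pt] : #|parts m :\ s| == 1.
  by move: c2; rewrite (cardsD1 s (parts m)) inE ms.
have : t \in parts m :\ s by rewrite pt inE.
rewrite !inE => /andP [ts mt].
exists t; first by split=> //; have := hs t; rewrite -val_eqE /= in ts; lia.
apply/ffunP => i; rewrite ffunE; case: (i =P s) => [->//|/eqP ni].
case: (i =P t) => [->//|/eqP nt].
apply: val_inj => /=; apply/eqP; rewrite -leqn0 leqNgt; apply: contraNN nt => mi.
by rewrite -in_set1 -pt !inE ni.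
Qed.

Lemma card_count (T : finType) (P : pred T) : #|P| = count P (enum T).
Proof. by rewrite enumT cardE /enum_mem size_filter. Qed.

Lemma card_one_size :
  #|[pred p : {ffun 'I_n.+1 -> 'I_n.+1} * 'I_n.+1 | omega_partition p.1 p.2 && (#|parts p.1| ==
    1)]|
  = size (pairs n).
Proof.
rewrite card_count -count_predT.
apply: (count_bij (f := fun p : {ffun 'I_n.+1 -> 'I_n.+1} * 'I_n.+1 =>
  (nat_of_ord (p.1 p.2), nat_of_ord p.2))
                  (g := fun '(a, s) => (mult1 (inord s) (inord a), inord s)));
  rewrite ?enum_uniq ?pairs_uniq //.
- case=> m s _ /= /andP [ok c1]; have ms : 0 < m s by case/and5P: ok.
  have e := mult1E ms c1.
  move: ok; rewrite {1}e omega_partition_mult1 => /and3P [_ s0 eN].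
  by rewrite mem_pairs ms s0 eN !inord_val -e.
- case=> a s; rewrite mem_pairs => /and3P [a0 s0 /eqP E] _.
  have an : a < n.+1 by nia.
  have sn : s < n.+1 by nia.
  rewrite mem_enum /= omega_partition_mult1 parts_mult1 !inordK // cards1 a0 s0 E ffunE !eqxx.
  by rewrite inordK.
Qed.

Lemma card_two_sizes :
  #|[pred p : {ffun 'I_n.+1 -> 'I_n.+1} * 'I_n.+1 | omega_partition p.1 p.2 && (#|parts p.1| ==
    2)]|
  = count (fun '((a, s), (b, t)) => (s < t) && (~~ odd t || (t < s.*2))) (quads n).
Proof.
(* On the partitions counted here, removing the smallest size leaves exactly one, so the default
   [ord0] is not reached. *)
pose other (p : {ffun 'I_n.+1 -> 'I_n.+1} * 'I_n.+1) := odflt ord0 [pick t in parts p.1 :\ p.2].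
have otherE s t (a b : 'I_n.+1) : s < t -> 0 < a -> 0 < b -> other (mult2 s t a b, s) = t.
  move=> st a0 b0; have ne : s != t by rewrite -val_eqE /= ltn_eqF.
  rewrite /other /= parts_mult2 //; case: pickP => [i|/(_ t)]; rewrite !inE.
    by case: (i =P s) => //= _ /eqP.
  by rewrite eqxx orbT andbT eq_sym ne.
rewrite card_count.
apply: (count_bij (f := fun p : {ffun 'I_n.+1 -> 'I_n.+1} * 'I_n.+1 =>
  ((nat_of_ord (p.1 p.2), nat_of_ord p.2), (nat_of_ord (p.1 (other p)), nat_of_ord (other p))))
   (g := fun '((a, s), (b, t)) => (mult2 (inord s) (inord t) (inord a) (inord b), inord s)));
  rewrite ?enum_uniq ?quads_uniq //.
- case=> m s _ /= /andP [ok c2]; have ms : 0 < m s by case/and5P: ok.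
  have [t [st mt] e] := mult2E ok c2.
  have -> : other (m, s) = t by rewrite e otherE.
  move: ok; rewrite {1}e omega_partition_mult2 // => /and4P [_ s0 eN odt].
  by rewrite mem_quads ms s0 mt eN st -mul2n !inord_val -e (leq_ltn_trans _ st).
- case=> [[a s] [b t]]; rewrite mem_quads => /and5P [a0 s0 b0 t0 /eqP E] /andP [st odt].
  have an : a < n.+1 by nia.
  have sn : s < n.+1 by nia.
  have bn : b < n.+1 by nia.
  have tn : t < n.+1 by nia.
  have st' : (inord s : 'I_n.+1) < (inord t : 'I_n.+1) by rewrite !inordK.
  have ne : (inord s : 'I_n.+1) != inord t by rewrite -val_eqE /= ltn_eqF.
  rewrite mem_enum /= otherE ?inordK // omega_partition_mult2 ?inordK // mul2n a0 s0 E eqxx odt.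
  rewrite parts_mult2 ?inordK // cards2 ne; split=> //.
  by rewrite !ffunE eqxx eq_sym (negPf ne) eqxx !inordK.
Qed.

Lemma pbar_omega_counts :
  pbar_omega n = size (pairs n)
    + 2 * count (fun '((a, s), (b, t)) => (s < t) && (~~ odd t || (t < s.*2))) (quads n) %[mod 4].
Proof. by rewrite pbar_omega_mod4 card_one_size card_two_sizes. Qed.
End Multiplicities.

(** If P counts xy = n with x < y, then both the number of divisors and twice the two-size count
    contribute 2P, which vanishes modulo 4 in total. *)
Lemma pbar_omega_squares n :
  pbar_omega n = square n
    + 2 * (sum_of_squares n
           + twice_square n) %[mod 4].
Proof.
rewrite pbar_omega_counts size_pairs count_pairs_diag.
(* Since s > 0, the bound t >= 2s already implies s < t. *)
rewrite (@count_split _ _ _ (fun '((a, s), (b, t)) => s < t < s.*2)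
  (fun '((a, s), (b, t)) => ~~ odd t && (s.*2 <= t))); last first.
  by intro_quad; lia.
have := count_quads_lt_double n.
have := count_quads_even_ge_double_pairs n.
do 2 move: (nat_of_bool [exists _, _]) => ?.
do !move: (count _ (quads n)) => ?.
move: (count _ (pairs n)) => ?.
rewrite !oddD => /(congr1 nat_of_bool) h1 /(congr1 nat_of_bool) h2.
lia.
Qed.

(** * The right-hand side as counts of lattice points *)

Definition grid (K : nat) : seq (nat * nat) := allpairs pair (iota 0 K) (iota 0 K).

Lemma mem_grid K x y : ((x, y) \in grid K) = (x < K) && (y < K).
Proof. by rewrite mem_allpairs_pair !mem_iota. Qed.

Lemma grid_uniq K : uniq (grid K).
Proof. by rewrite uniq_allpairs_pair ?iota_uniq. Qed.

Lemma sum_grid K (P : rel nat) :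
  \sum_(m < K) \sum_(k < K) (P m k : nat) = count (fun '(m, k) => P m k) (grid K).
Proof.
rewrite -sum1_count [RHS]big_mkcond /grid big_allpairs -(big_mkord xpredT (fun m =>
  \sum_(k < K) (P m k : nat))).
rewrite /index_iota subn0; apply: eq_bigr => m _.
rewrite -(big_mkord xpredT (fun k => (P m k : nat))) /index_iota subn0.
by apply: eq_bigr => k _; case: (P m k).
Qed.

Lemma count_grid_sym K (P : rel nat) : symmetric P ->
  count (fun '(m, k) => P m k) (grid K) =
  count (fun '(m, k) => (m == k) && P m k) (grid K)
  + 2 * count (fun '(m, k) => (k < m) && P m k) (grid K).
Proof.
move=> symP.
rewrite (@count_split _ _ _ (fun '(m, k) => (m == k) && P m k) (fun '(m, k) =>
  (m != k) && P m k)); last first.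
  by case=> m k _; case: eqP; case: (P m k).
rewrite (@count_split _ _ (fun '(m, k) => (m != k) && P m k) (fun '(m, k) =>
  (k < m) && P m k) (fun '(m, k) => (m < k) && P m k)); last first.
  by case=> m k _; case: ltngtP; case: (P m k).
rewrite mul2n -addnn; congr (_ + (_ + _)).
by apply: (count_bij (f := fun '(x, y) => (y, x)) (g := fun '(x, y) => (y, x)));
  rewrite ?grid_uniq // => -[x y]; rewrite !mem_grid symP => /andP [-> ->].
Qed.

Lemma count_unique (T : eqType) (s : seq T) (P : pred T) :
  uniq s -> {in s &, forall x y, P x -> P y -> x = y} -> count P s = has P s.
Proof.
move=> us inj; case: hasP => [[x xs Px]|h].
  rewrite (@eq_in_count _ _ (pred1 x)) ?count_uniq_mem ?xs // => y ys /=.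
  by apply/idP/eqP => [Py|-> //]; apply: inj.
by apply/eqP; rewrite -leqn0 leqNgt -has_count; apply/hasP.
Qed.

(** 2 (m^2 + k^2) = (m + k)^2 + (m - k)^2. The diagonal gives n = (2k)^2, where every root of the
    even n is even; k = 0 is separated because it yields two equal squares, n = 2m^2. *)
Lemma count_grid_even n : 0 < n -> ~~ odd n ->
  count (fun '(m, k) => 2 * (m ^ 2 + k ^ 2) == n) (grid n.+1) =
  square n
    + 2 * (sum_of_squares n
           + twice_square n).
Proof.
move=> n0 en.
rewrite (@eq_count _ _ (fun '(m, k) => 2 * (m * m + k * k) == n)); last by case=> m k;
  rewrite !mulnn.
rewrite (@count_grid_sym _ (fun m k => 2 * (m * m + k * k) == n)); last by move=> m k;
  rewrite addnC.
rewrite (@count_split _ _ (fun '(m, k) => (k < m) && _)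
  (fun '(m, k) => (0 < k < m) && (2 * (m * m + k * k) == n))
  (fun '(m, k) => [&& k == 0, 0 < m & 2 * (m * m + k * k) == n])); last first.
  by case=> m [|k] _; case: (_ == n); rewrite ?andbT ?andbF ?orbF.
congr (_ + 2 * (_ + _)).
- rewrite count_unique ?grid_uniq //; last first.
    case=> m k [m' k'] _ _ /andP [/eqP -> /eqP E] /andP [/eqP -> /eqP E'].
    have -> // : k = k' by nia.
  congr nat_of_bool; apply/hasP/existsP => [[[m k]]|[x /andP [x0 /eqP E]]].
    rewrite mem_grid => /andP [mn kn] /andP [/eqP ? /eqP E]; subst m.
    have kn' : k.*2 < n.+1 by nia.
    by exists (Ordinal kn'); apply/andP; split => /=; [lia | apply/eqP; lia].
  move: (nat_of_ord x) x0 E => {}x x0 E.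
  have ex : ~~ odd x by move: en; rewrite -E oddM andbb.
  exists (x./2, x./2); first by rewrite mem_grid; nia.
  have e2 : x = x./2.*2 by lia.
  rewrite eqxx /=; apply/eqP; rewrite -E [in RHS]e2; lia.
- apply: (count_bij (f := fun '(m, k) => ((m + k, m + k), (m - k, m - k)))
    (g := fun '((c, s), (a, u)) => ((c + a)./2, (c - a)./2))); rewrite ?quads_uniq ?grid_uniq //.
  + case=> m k; rewrite mem_grid => /andP [mn kn] /andP [/andP [k0 km] /eqP E].
    have [l ?] : exists l, m = k + l by exists (m - k); lia.
    subst m; rewrite addKn; split; [rewrite mem_quads; nia | lia | congr (_, _); lia].
  + intro_quad => /and3P [/eqP ? /eqP ? lt]; subst s t.
    have o : odd a = odd b by nia.
    have [l ?] : exists l, a = b + l.*2 by exists (a - b)./2; lia.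
    subst a.
    have -> : (b + l.*2 + b)./2 = b + l by lia.
    have -> : (b + l.*2 - b)./2 = l by lia.
    split; [rewrite mem_grid; nia | nia | congr (_, _, (_, _)); lia].
- rewrite count_unique ?grid_uniq //; last first.
    case=> m k [m' k'] _ _ /and3P [/eqP -> m0 /eqP E] /and3P [/eqP -> m0' /eqP E'].
    have -> // : m = m' by nia.
  congr nat_of_bool; apply/hasP/existsP => [[[m k]]|[x /andP [x0 /eqP E]]].
    rewrite mem_grid => /andP [mn kn] /and3P [/eqP ? m0 /eqP E]; subst k.
    by exists (Ordinal mn); apply/andP; split => //=; apply/eqP; lia.
  exists (nat_of_ord x, 0); first by rewrite mem_grid ltn_ord.
  by rewrite x0 /=; apply/eqP; lia.
Qed.

(** 1 + 2m (m + 1) + 2k (k + 1) = (m + k + 1)^2 + (m - k)^2. The diagonal gives (2k + 1)^2, and off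
    it the two roots have opposite parity, so k = 0 needs no separate treatment. *)
Lemma count_grid_odd n : odd n ->
  count (fun '(m, k) => 1 + (2 * (m * m.+1) + 2 * (k * k.+1)) == n) (grid n.+1) =
  square n
    + 2 * sum_of_squares n.
Proof.
move=> on.
rewrite (@count_grid_sym _ (fun m k => 1 + (2 * (m * m.+1) + 2 * (k * k.+1)) == n)); last first.
  by move=> m k; rewrite [2 * (k * _) + _]addnC.
congr (_ + 2 * _).
- rewrite count_unique ?grid_uniq //; last first.
    case=> m k [m' k'] _ _ /andP [/eqP -> /eqP E] /andP [/eqP -> /eqP E'].
    have -> // : k = k' by nia.
  congr nat_of_bool; apply/hasP/existsP => [[[m k]]|[x /andP [x0 /eqP E]]].
    rewrite mem_grid => /andP [mn kn] /andP [/eqP ? /eqP E]; subst m.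
    have kn' : k.*2.+1 < n.+1 by nia.
    by exists (Ordinal kn'); apply/andP; split => //=; apply/eqP; lia.
  move: (nat_of_ord x) x0 E => {}x x0 E.
  have ex : odd x by move: on; rewrite -E oddM andbb.
  exists (x./2, x./2); first by rewrite mem_grid; nia.
  have e2 : x = x./2.*2.+1 by lia.
  rewrite eqxx /=; apply/eqP; rewrite -E [in RHS]e2; lia.
- apply: (count_bij (f := fun '(m, k) => ((m + k.+1, m + k.+1), (m - k, m - k)))
    (g := fun '((c, s), (a, u)) => ((c + a)./2, (c - a)./2))); rewrite ?quads_uniq ?grid_uniq //.
  + case=> m k; rewrite mem_grid => /andP [mn kn] /andP [km /eqP E].
    have [l ?] : exists l, m = k + l by exists (m - k); lia.
    subst m; rewrite addKn; split; [rewrite mem_quads; nia | lia | congr (_, _); lia].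
  + intro_quad => /and3P [/eqP ? /eqP ? lt]; subst s t.
    have o : odd a = ~~ odd b by nia.
    have [l ?] : exists l, a = b + l.*2.+1 by exists (a - b)./2; lia.
    subst a.
    have -> : (b + l.*2.+1 + b)./2 = b + l by lia.
    have -> : (b + l.*2.+1 - b)./2 = l by lia.
    split; [rewrite mem_grid; nia | nia | congr (_, _, (_, _)); lia].
Qed.

Lemma Posz_sum_grid K (P : rel nat) :
  (\sum_(m < K) \sum_(k < K) (P m k : nat)%:Z = (count (fun '(m, k) => P m k) (grid K))%:Z)%R.
Proof.
rewrite -sum_grid (big_morph Posz PoszD (erefl (Posz 0))); apply: eq_bigr => m _.
by rewrite (big_morph Posz PoszD (erefl (Posz 0))).
Qed.

(** The sign depends on N alone: m + k has the parity of m^2 + k^2 = N/2. *)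
Lemma rhs_coef_counts N : 0 < N ->
  (rhs_coef N = (-1) ^+ N./2 * (count (fun '(m, k) =>
    (2 * (m ^ 2 + k ^ 2))%N == N) (grid N.+1))%:Z
  + (count (fun '(m, k) => (1 + (2 * (m * m.+1) + 2 * (k * k.+1)))%N == N) (grid N.+1))%:Z)%R.
Proof.
move=> N0; rewrite /rhs_coef -(Posz_sum_grid _ (fun m k => 2 * (m ^ 2 + k ^ 2) == N))
  -(Posz_sum_grid _ (fun m k => 1 + (2 * (m * m.+1) + 2 * (k * k.+1)) == N)).
rewrite (gtn_eqF N0) /= GRing.oppr0 GRing.add0r GRing.mulr_sumr; congr (_ + _)%R;
  apply: eq_bigr => m _.
  rewrite GRing.mulr_sumr; apply: eq_bigr => k _.
  case: eqP => [E|_]; rewrite ?GRing.mulr1 ?GRing.mulr0 //.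
  rewrite -GRing.signr_odd -[in RHS]GRing.signr_odd; congr (_ ^+ _)%R; congr nat_of_bool.
  have -> : N./2 = m ^ 2 + k ^ 2 by lia.
  by rewrite !oddD !oddX.
by apply: eq_bigr => k _; case: eqP.
Qed.

Theorem theorem4p4 : forall N : nat, (lhs_coef N = rhs_coef N %[mod 4])%Z.
Proof.
(* At N = 0 the term -1 cancels the contribution of m = n = 0. *)
case=> [|n]; first by rewrite /lhs_coef /rhs_coef !big_ord1.
rewrite rhs_coef_counts // [lhs_coef _]/=; move: n.+1 (ltn0Sn n) => {n} N N0.
have : (pbar_omega N = pbar_omega N %[mod 4])%Z by [].
rewrite [in X in _ = X -> _]modz_nat pbar_omega_squares -modz_nat => ->.
(* Each parity of N keeps only one of the two double sums. *)
have [oN|eN] := boolP (odd N).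
  rewrite (count_grid_odd oN) (@eq_count _ (fun '(m, k) => 2 * _ == N) pred0) ?count_pred0;
    last first.
    by case=> m k /=; case: eqP => // E; move: oN; rewrite -E mul2n odd_double.
  rewrite GRing.mulr0 GRing.add0r; congr (_ %% _)%Z; congr Posz; congr (_ + 2 * _).
  case: existsP => [[x /andP [_ /eqP E]]|_]; last by rewrite addn0.
  by move: oN; rewrite -E; lia.
rewrite (count_grid_even N0 eN) (@eq_count _ (fun '(m, k) => 1 + _ == N) pred0) ?count_pred0;
  last first.
  by case=> m k /=; case: eqP => // E; move: eN; rewrite -E -mulnDr mul2n oddD odd_double.
rewrite GRing.addr0 -GRing.signr_odd.
have [oM|_] := boolP (odd N./2); last by rewrite GRing.expr0 GRing.mul1r.
(* An even square is divisible by 4, whereas N/2 is odd. *)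
have -> : square N = false.
  apply/existsP => -[x /andP [_ /eqP E]].
  move: (nat_of_ord x) E => {}x E; have [y ?] : exists y, x = y.*2 by exists x./2; nia.
  subst x; nia.
move: (count _ _ + _) => y; rewrite GRing.expr1 GRing.mulN1r add0n.
(* Without the square term both sides are 2y up to sign, and 2y - (-2y) = 4y. *)
by apply/eqP; rewrite eqz_mod_dvd; apply/dvdzP; exists (Posz y); lia.
Qed.
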